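(* Let $B$ be a separable Banach space, $p\in[1,\infty)$, and let $X,Y\in L^p(\mathbb{P},B)$ have laws $\mu,\nu$ respectively and satisfy $\mathbb{E}[Y|X]=X$. Let $\Pi_1=(P_{1,i})_i$ and $\Pi_2=(P_{2,j})_j$ be finite partitions of $B$ made of Borel sets, and define $$\hat{X}:=\mathbb{E}[X\,|\,\sigma(X^{-1}(\Pi_1))],\qquad \hat{Y}:=\mathbb{E}[Y\,|\,\sigma(X^{-1}(\Pi_1))\vee\sigma(Y^{-1}(\Pi_2))],$$ with laws $\hat\mu,\hat\nu$ respectively. Then $$\mathcal{W}_p(\mu,\hat\mu)^p\leq\|X-\hat X\|^p_{L^p(\mathbb{P},B)}\leq\sum_{i}(\mathrm{diam}(P_{1,i}))^p\,\mu(P_{1,i}),$$ $$\mathcal{W}_p(\nu,\hat\nu)^p\leq\|Y-\hat Y\|^p_{L^p(\mathbb{P},B)}\leq\sum_{j}(\mathrm{diam}(P_{2,j}))^p\,\nu(P_{2,j}),$$ where the first sum is over those $i$ with $\mu(P_{1,i})>0$ and the second over those $j$ with $\nu(P_{2,j})>0$. In particular, let $\Pi^n_1=(P^n_{1,i})_i$, $\Pi^n_2=(P^n_{2,j})_j$, $n\in\mathbb{N}$, be finite Borel partitions of $B$ such that for $k=1,2$ one has $\sigma(\Pi^n_k)\subseteq\sigma(\Pi^{n+1}_k)$ for all $n$ and $\sigma(\bigcup_n\Pi^n_k)=\mathcal{B}(B)$, and let $\mu_n,\nu_n$ be the laws of $X_n:=\mathbb{E}[X|\sigma(X^{-1}(\Pi_1^n))]$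 and $Y_n:=\mathbb{E}[Y|\sigma(X^{-1}(\Pi_1^n))\vee\sigma(Y^{-1}(\Pi_2^n))]$. Then for all $n$ $$\mathcal{W}_p(\mu,\mu_n)^p\leq\sum_i(\mathrm{diam}(P^n_{1,i}))^p\,\mu(P^n_{1,i}),\qquad \mathcal{W}_p(\nu,\nu_n)^p\leq\sum_j(\mathrm{diam}(P^n_{2,j}))^p\,\nu(P^n_{2,j}),$$ with the sums again restricted to sets of positive measure.
   Context: $(\Omega,\mathcal{F},\mathbb{P})$ is the underlying probability space; $L^p(\mathbb{P},B)$ is the space of $B$-valued random variables $X$ with $\|X\|_{L^p(\mathbb{P},B)}:=(\mathbb{E}\|X\|^p)^{1/p}<\infty$; conditional expectations are in the Bochner sense; $\mathcal{B}(B)$ is the Borel $\sigma$-algebra of $B$. For a partition $\Pi$ of $B$, $X^{-1}(\Pi):=\{X^{-1}(P):P\in\Pi\}$. The diameter of $E\subseteq B$ is $\mathrm{diam}(E):=\sup_{x,y\in E}\|x-y\|\in[0,\infty]$ (so the right-hand sides may equal $+\infty$). The $p$-Wasserstein distance is $\mathcal{W}_p(\mu,\nu)=\left(\inf_{\pi}\int_{B\times B}\|x-y\|^p\,d\pi(x,y)\right)^{1/p}$, where the infimum runs over all Borel probabilities $\pi$ on $B\times B$ with marginals $\mu$ and $\nu$. *)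

(* Defs.v *)
From HB Require Import structures.
From mathcomp Require Import all_boot all_order all_algebra.
From mathcomp Require Import all_classical all_reals all_analysis.

Set Implicit Arguments.
Unset Strict Implicit.
Unset Printing Implicit Defensive.

Import Order.TTheory GRing.Theory Num.Theory.
Import numFieldNormedType.Exports.

Local Open Scope classical_set_scope.
Local Open Scope ring_scope.

Definition separable (T : topologicalType) := exists2 D : set T, countable D & dense D.

(* [borel B] is [B] carrying its Borel sigma-algebra.  As [g_sigma_algebraType]
   hides the normed structure, elements are cast back to [B] where needed. *)
Notation borel B := (g_sigma_algebraType (@open B)).

Section bochner.
Context {d : measure_display} {T : measurableType d} {R : realType}.
Context {B : completeNormedModType R}.
Variable P : probability T R.

Definition simple_integral (s : T -> B) : B :=
  \sum_(b \in range s) fine (P (s @^-1` [set b])) *: b.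

(* The quantification over [{mfun _ >-> _}] makes the simple functions Borel
   measurable; each [s n] is integrable since [P] is finite. *)
Definition bochner_approx (f : T -> B) (s : nat -> {mfun T >-> borel B}) :=
  (forall n, finite_set (range (s n))) /\
  (\int[P]_w (`|f w - (s n w : B)|%:E) @[n --> \oo] --> 0)%E.

Definition bochner_integrable (f : T -> B) :=
  measurable_fun setT (f : T -> borel B) /\ exists s, bochner_approx f s.

(* For Bochner integrable [f] the limit exists and does not depend on the
   approximating sequence. *)
Definition bochner (f : T -> B) : B :=
  xget 0 [set v : B | exists s, bochner_approx f s /\
    simple_integral (s n : T -> B) @[n --> \oo] --> v].

(* [g] is a version of E[f | G]; [G] is meant to be a sub-sigma-algebra of the
   measurable sets.  Integrability of [f] is part of the definition, so that
   no junk value of [bochner] is involved. *)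
Definition is_cond_exp (G : set (set T)) (f g : T -> B) :=
  [/\ bochner_integrable f, bochner_integrable g,
      (forall U : set (borel B), measurable U -> G (g @^-1` U)) &
      forall A, G A ->
        bochner (fun w => \1_A w *: f w) = bochner (fun w => \1_A w *: g w)].

Definition normLp (p : R) (f : T -> B) : \bar R :=
  Lnorm P p%:E (fun w => `|f w|%:E).

End bochner.

Section wasserstein.
Context {R : realType} {B : completeNormedModType R}.
Local Open Scope ereal_scope.

Definition coupling (mu nu : probability (borel B) R)
    (pi : probability (borel (B * B)%type) R) :=
  forall A : set (borel B), measurable A ->
    pi (fst @^-1` A) = mu A /\ pi (snd @^-1` A) = nu A.

Definition wasserstein (p : R) (mu nu : probability (borel B) R) : \bar R :=
  (ereal_inf [set \int[pi]_z ((`|(z : B * B).1 - (z : B * B).2| `^ p)%R%:E)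
             | pi in coupling mu nu]) `^ p^-1.

(* The value on the empty set is -oo, but cells of a partition are nonempty. *)
Definition diam (E : set B) : \bar R :=
  ereal_sup [set `|z.1 - z.2|%:E | z in E `*` E].

Definition diam_sum (p : R) (mu : probability (borel B) R) (m : nat)
    (Pi : 'I_m -> set B) : \bar R :=
  \sum_(i < m | 0 < mu (Pi i)) diam (Pi i) `^ p * mu (Pi i).

End wasserstein.

Definition borel_partition (R : realType) (B : completeNormedModType R)
    (m : nat) (Pi : 'I_m -> set B) :=
  partition [set: 'I_m] Pi [set: B] /\
  forall i, measurable (Pi i : set (borel B)).

Definition sigma_of (S I : Type) (Pi : I -> set S) : set (set S) :=
  <<s range Pi >>.

Definition sigma_preim (S U I : Type) (X : S -> U) (Pi : I -> set U) :
  set (set S) := <<s preimage_set_system setT X (range Pi) >>.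

Definition sigma_join (S : Type) (G H : set (set S)) : set (set S) :=
  <<s G `|` H >>.

(* Main.v *)
Require Import Defs.
From HB Require Import structures.
From mathcomp Require Import all_boot all_order all_algebra.
From mathcomp Require Import all_classical all_reals all_analysis.
From mathcomp Require Import measurable_realfun.

Set Implicit Arguments.
Unset Strict Implicit.
Unset Printing Implicit Defensive.

Import Order.TTheory GRing.Theory Num.Theory.
Import numFieldNormedType.Exports.
Local Open Scope classical_set_scope.
Local Open Scope ring_scope.

(** Conditioning on the sigma-algebra generated by a finite partition of [T]
    averages over each cell, so the conditional expectation moves a point by at
    most the diameter of the image of its cell.

    Describe such a sigma-algebra [G] by a map [Z] to a set of labels with
    finitely many values, whose fibres are the atoms of [G]. A version [g] of
    E[f | G] is constant, say equal to [c], on an atom [A], because the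
    preimage of a point under [g] is a union of atoms. The defining equation of
    the conditional expectation on [A] says that [P A *: c] is the Bochner
    integral of [\1_A *: f], while [P A *: f w0] is that of [\1_A *: f w0]
    for [w0] in [A]; hence [P A * |f w0 - c|] is at most the integral over [A]
    of [|f - f w0|], that is, at most [P A] times the diameter of [f @` A]
    ([cond_exp_atom_dist]). Dividing by [P A] whenever it is positive gives
    the bound almost everywhere ([cond_exp_diam]). For [X] the atoms are the
    sets [X @^-1` Pi1 i], for [Y] they are the sets
    [X @^-1` Pi1 i `&` Y @^-1` Pi2 j], which [Y] maps into [Pi2 j]. Raising to
    the power [p] and integrating cell by cell bounds the L^p distance
    ([Lp_dist_le_diam_sum]).

    The Wasserstein bound takes the joint law of a variable and its conditional
    expectation as coupling ([wasserstein_le_Lp_dist]). The conditional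
    expectation takes finitely many values, so the pair is measurable for the
    Borel sets of the product by working on one value at a time.

    What is used of the Bochner integral is the single estimate
    [bochner_dist]: the integral of [h] is within the L^1 distance of [h] and
    [t] from the integral of a finite-valued [t]. It contains the existence of
    the integral, which is where completeness of [B] is needed. *)

(** * Maps with finitely many values *)

Section finite_valued.
Context {d : measure_display} {T : measurableType d}.

(** The values lie in a bare type: no sigma-algebra on [J] has to be chosen, so
    labels, vectors and pairs of vectors are all treated alike. *)
Definition finite_valued {J : Type} (u : T -> J) :=
  finite_set (range u) /\ forall j, measurable (u @^-1` [set j]).

Lemma finite_valued_map (J K : choiceType) (u : T -> J) (phi : J -> K) :
  finite_valued u -> finite_valued (phi \o u).
Proof.
move=> [fu mu]; split; first by rewrite -(image_comp u phi); exact: finite_image.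
move=> k; rewrite (_ : _ @^-1` _ =
  \bigcup_(j in range u `&` [set j | phi j = k]) u @^-1` [set j]).
  by apply: fin_bigcup_measurable => //; exact: finite_setIl.
apply/seteqP; split => w /=; first by move=> uwk; exists (u w) => //; split.
by move=> [j [_ /= <-] ->].
Qed.

Lemma finite_valued_pair (J K : choiceType) (u : T -> J) (v : T -> K) :
  finite_valued u -> finite_valued v -> finite_valued (fun w => (u w, v w)).
Proof.
move=> [fu mu] [fv mv]; split.
  apply: (@sub_finite_set _ _ (range u `*` range v)).
    by move=> _ [w _ <-]; split; exists w.
  exact: finite_setX.
move=> [j k]; rewrite (_ : _ @^-1` _ = u @^-1` [set j] `&` v @^-1` [set k]).
  exact: measurableI.
by apply/seteqP; split => w /= [-> ->].
Qed.

(** The tool behind the measurability proofs below: in a difference or a pair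
    with a finite-valued map, that map may be treated as a constant. *)
Lemma measurable_glue (J : choiceType) d' (U : measurableType d')
    (u : T -> J) (h : J -> T -> U) :
  finite_valued u -> (forall j, measurable_fun setT (h j)) ->
  measurable_fun setT (fun w => h (u w) w).
Proof.
move=> [fu mu] mh _ V mV; rewrite setTI.
rewrite (_ : _ @^-1` _ =
  \bigcup_(j in range u) (u @^-1` [set j] `&` h j @^-1` V)).
  apply: fin_bigcup_measurable => // j _; apply: measurableI; first exact: mu.
  by rewrite -[X in measurable X]setTI; exact: mh.
apply/seteqP; split => w /=; first by exists (u w) => //; exists w.
by move=> [j _ [/= <-]].
Qed.

Lemma finite_valued_mem (A : set T) :
  measurable A -> finite_valued (fun w => w \in A).
Proof.
move=> mA; split; first exact: finite_finset.
case.
  rewrite (_ : _ @^-1` _ = A)//.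
  by apply/seteqP; split => w /=; [move/set_mem|move/mem_set].
rewrite (_ : _ @^-1` _ = ~` A); first exact: measurableC.
apply/seteqP; split => w /=; first by move=> wA Aw; rewrite mem_set in wA.
by move=> nAw; apply/negbTE; rewrite notin_setE.
Qed.

End finite_valued.

Lemma continuous_borel_measurable (R : realType) (U V : normedModType R)
    (f : U -> V) :
  continuous f -> measurable_fun setT (f : borel U -> borel V).
Proof.
move=> cf; apply: (@measurability _ _ (borel U) (borel V) setT f open) => //.
move=> _ [A oA <-]; rewrite setTI; apply: sub_sigma_algebra.
exact: open_comp.
Qed.

Lemma continuous_real_measurable (R : realType) (U : normedModType R)
    (f : U -> R) :
  continuous f -> measurable_fun setT (f : borel U -> R).
Proof.
move=> cf.
apply: (measurability _ (measurable_realfun.RGenOInfty.measurableE R)).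
move=> _ [_ [x ->] <-]; rewrite setTI; apply: sub_sigma_algebra.
by apply: open_comp => //; exact: interval_open.
Qed.

Lemma borel_measurable_set1 (R : realType) (U : normedModType R) (x : U) :
  measurable ([set x] : set (borel U)).
Proof.
rewrite -[[set x]]setCK; apply: measurableC; apply: sub_sigma_algebra.
apply: closed_openC; apply: accessible_closed_set1.
exact/hausdorff_accessible/norm_hausdorff.
Qed.

(** * Integrals of finite-valued maps *)

Section simple_integral_theory.
Context {d : measure_display} {T : measurableType d} {R : realType}.
Context {B : completeNormedModType R}.
Variable P : probability T R.

Lemma finite_valued_mfun (s : {mfun T >-> borel B}) :
  finite_set (range s) -> finite_valued (s : T -> B).
Proof.
move=> fs; split => // b.
rewrite -[X in measurable X]setTI; apply: (@measurable_funPT _ _ _ _ s) => //.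
exact: borel_measurable_set1.
Qed.

Lemma finite_valued_measurable (u : T -> B) :
  finite_valued u -> measurable_fun setT (u : T -> borel B).
Proof.
move=> fu; exact: (@measurable_glue _ _ B _ (borel B) u (fun b _ => b)).
Qed.

(** Computes the integral along the fibres of any [u] through which the map
    factors, instead of along its own values. Two maps can then be compared on
    the common refinement given by the pair of both. *)
Lemma simple_integral_comp (J : choiceType) (u : T -> J) (phi : J -> B) :
  finite_valued u -> simple_integral P (phi \o u) =
  \sum_(j \in range u) fine (P (u @^-1` [set j])) *: phi j.
Proof.
move=> [fu mu]; rewrite /simple_integral.
have fphi : finite_set (range (phi \o u)).
  by rewrite -(image_comp u phi); exact: finite_image.
(* Splitting the fibre over [b] into fibres of [u] leaves a double sum; after
   exchanging, only [b = phi j] contributes to the term of [j]. *)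
have PE b : fine (P ((phi \o u) @^-1` [set b])) =
    \sum_(j \in range u) (if phi j == b then fine (P (u @^-1` [set j])) else 0).
  rewrite (_ : _ @^-1` _ =
    \bigcup_(j in range u) (u @^-1` ([set j] `&` [set j | phi j = b]))); last first.
    apply/seteqP; split => w /=; first by exists (u w) => //; exists w.
    by move=> [j _ /= [->]].
  have cellE j : u @^-1` ([set j] `&` [set j | phi j = b]) =
      if phi j == b then u @^-1` [set j] else set0.
    case: ifPn => [/eqP jb|/eqP jb]; apply/seteqP; split => w //=.
    - by move=> [].
    - by move=> ->.
    - by move=> [->].
  have mcell j : measurable (u @^-1` ([set j] `&` [set j | phi j = b])).
    by rewrite cellE; case: ifP.
  rewrite measure_fin_bigcup//; last by move=> i j _ _ [w [/= [<- _] [<-]]].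
  rewrite !fsbig_finite//= -sum_fine; last by move=> j _; exact: fin_num_measure.
  by apply: eq_bigr => j _; rewrite cellE; case: ifPn; rewrite ?measure0.
under eq_fsbigr do rewrite PE.
rewrite (fsbig_finite _ _ fphi) (fsbig_finite _ _ fu)/=.
under eq_bigr do rewrite fsbig_finite// scaler_suml.
rewrite exchange_big/= big_seq [RHS]big_seq; apply: eq_bigr => j jin.
have [w _ uwj] : range u j by apply/set_mem; rewrite -in_fset_set.
rewrite (bigD1_seq (phi j)) ?finmap.fset_uniq//=; last first.
  have /mem_set : range (phi \o u) (phi j) by exists w => //=; rewrite uwj.
  by rewrite -in_fset_set.
rewrite eqxx big1 ?addr0// => b; rewrite eq_sym => /negbTE ->.
by rewrite scale0r.
Qed.

Lemma integral_finite_valued (J : choiceType) (u : T -> J) (psi : J -> R) :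
  finite_valued u -> (forall j, 0 <= psi j) ->
  (\int[P]_w (psi (u w))%:E)%E =
  (\sum_(j \in range u) fine (P (u @^-1` [set j])) * psi j)%:E.
Proof.
move=> fvu psi0; have [fu mu] := fvu.
have mpsi : measurable_fun [set: T] (EFin \o (psi \o u)).
  apply/measurable_EFinP.
  exact: (@measurable_glue _ _ J _ R u (fun j _ => psi j)).
have TE : setT =
    \big[setU/set0]_(j <- finmap.enum_fset (fset_set (range u))) u @^-1` [set j].
  rewrite bigsetU_fset_set//; apply/seteqP; split => // w _.
  by exists (u w) => //; exists w.
rewrite {1}TE ge0_integral_bigsetU ?finmap.fset_uniq//; last 3 first.
- by move=> i j _ _ [w [/= <- <-]].
- by rewrite -TE.
- by move=> w _; rewrite lee_fin.
rewrite fsbig_finite//= -sumEFin; apply: eq_bigr => j _.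
rewrite EFinM fineK ?fin_num_measure// muleC -integral_cst//.
by apply: eq_integral => w /set_mem /= ->.
Qed.

Lemma simple_integral_dist (s t : T -> B) :
  finite_valued s -> finite_valued t ->
  (`|simple_integral P s - simple_integral P t|%:E <=
   \int[P]_w `|s w - t w|%:E)%E.
Proof.
move=> fs ft; pose u w := (s w, t w).
have fu : finite_valued u by exact: finite_valued_pair.
rewrite (simple_integral_comp fst fu) (simple_integral_comp snd fu).
rewrite (integral_finite_valued (psi := fun z => `|z.1 - z.2|) fu)//.
rewrite lee_fin !fsbig_finite//; try by exact: fu.1.
rewrite -sumrB (le_trans (ler_norm_sum _ _ _))// ler_sum// => z _.
by rewrite -scalerBr normrZ ger0_norm// fine_ge0.
Qed.

End simple_integral_theory.

(** * The Bochner integral *)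

Section bochner_theory.
Context {d : measure_display} {T : measurableType d} {R : realType}.
Context {B : completeNormedModType R}.
Variable P : probability T R.
Implicit Types (h s t : T -> B).

Lemma measurable_norm_sub h s :
  measurable_fun setT (h : T -> borel B) -> finite_valued s ->
  measurable_fun setT (fun w => `|h w - s w|).
Proof.
move=> mh fs.
apply: (@measurable_glue _ _ B _ R s (fun b w => `|h w - b|)) => // b.
apply: (@measurableT_comp _ _ _ T (borel B) R
  (fun x : borel B => `|(x : B) - b|)) => //.
apply: (@continuous_real_measurable R B (fun x : B => `|x - b|)) => x.
by apply: cvg_norm; apply: cvgB => //; exact: cvg_cst.
Qed.

(** Applied to two terms of an approximating sequence of [h], this says that
    their integrals form a Cauchy sequence. *)
Lemma simple_integral_dist_via h s t :
  measurable_fun setT (h : T -> borel B) -> finite_valued s -> finite_valued t ->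
  (`|simple_integral P s - simple_integral P t|%:E <=
   \int[P]_w `|h w - s w|%:E + \int[P]_w `|h w - t w|%:E)%E.
Proof.
move=> mh fs ft; apply: (le_trans (simple_integral_dist P fs ft)).
have mhs : measurable_fun [set: T] (EFin \o (fun w => `|h w - s w|)).
  by apply/measurable_EFinP; exact: measurable_norm_sub.
have mht : measurable_fun [set: T] (EFin \o (fun w => `|h w - t w|)).
  by apply/measurable_EFinP; exact: measurable_norm_sub.
rewrite -ge0_integralD//.
apply: ge0_le_integral => //.
- apply/measurable_EFinP; apply: measurable_norm_sub => //.
  exact: finite_valued_measurable.
- exact: emeasurable_funD.
- by move=> w _; rewrite -EFinD lee_fin (distrC (h w)) ler_distD.
Qed.

Lemma approx_near h (s : nat -> {mfun T >-> borel B}) (e : R) :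
  bochner_approx P h s -> 0 < e ->
  \forall n \near \oo, (\int[P]_w `|h w - (s n w : B)|%:E < e%:E)%E.
Proof.
move=> [_ se] e0; apply: (se [set x | (x < e%:E)%E]).
exact: (nbhs_open_ereal_lt (f := fun=> e)).
Qed.

(** The limit exists because [B] is complete, so [bochner] does not fall back on
    its default value. *)
Lemma bochner_limit h : bochner_integrable P h ->
  exists2 s : nat -> {mfun T >-> borel B}, bochner_approx P h s &
    simple_integral P (s n : T -> B) @[n --> \oo] --> bochner P h.
Proof.
move=> [mh [s sh]].
suff : exists v : B, exists s : nat -> {mfun T >-> borel B}, bochner_approx P h s /\
    simple_integral P (s n : T -> B) @[n --> \oo] --> v.
  by move=> /(xgetPex (0 : B)) [s' [? ?]]; exists s'.
suff /cvg_ex[v sv] : cvgn (fun n => simple_integral P (s n : T -> B)).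
  by exists v, s.
apply/cauchy_cvgP/cauchy_exP => e e0.
have e20 : 0 < e / 2 by rewrite divr_gt0.
have [N _ sN] := approx_near sh e20.
exists (simple_integral P (s N : T -> B)); exists N => // n /= Nn.
rewrite -ball_normE/= -lte_fin.
have fs m : finite_valued (s m : T -> B) by apply: finite_valued_mfun; exact: sh.1.
apply: le_lt_trans (simple_integral_dist_via mh (fs N) (fs n)) _.
by rewrite (splitr e) EFinD lteD// sN/=.
Qed.

(** [simple_integral_dist_via] passed to the limit along an approximating
    sequence. Taking [t] equal to [h] shows that [bochner] extends
    [simple_integral]. *)
Lemma bochner_dist h t : bochner_integrable P h -> finite_valued t ->
  (`|bochner P h - simple_integral P t|%:E <= \int[P]_w `|h w - t w|%:E)%E.
Proof.
move=> ih ft; have [s sh sv] := bochner_limit ih; have mh := ih.1.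
have fs m : finite_valued (s m : T -> B) by apply: finite_valued_mfun; exact: sh.1.
apply/lee_addgt0Pr => e e0; have e20 : 0 < e / 2 by rewrite divr_gt0.
have vnear : \forall n \near \oo,
    `|bochner P h - simple_integral P (s n : T -> B)| < e / 2.
  by move/cvgrPdist_lt : sv; exact.
have [n [sn vn]] := filter_ex (filterI (approx_near sh e20) vnear).
rewrite (@le_trans _ _ (`|bochner P h - simple_integral P (s n : T -> B)|%:E +
   `|simple_integral P (s n : T -> B) - simple_integral P t|%:E)%E)//.
  by rewrite -EFinD lee_fin ler_distD.
rewrite (splitr e) EFinD [leRHS]addeC -addeA leeD//; first by rewrite lee_fin ltW.
apply: le_trans (simple_integral_dist_via mh (fs n) ft) _.
by rewrite leeD2r// ltW.
Qed.

Lemma bochner_simple s : finite_valued s -> bochner P s = simple_integral P s.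
Proof.
move=> fs; apply/eqP; rewrite -subr_eq0 -normr_le0 -lee_fin.
have int0 : (\int[P]_w `|s w - s w|%:E = 0)%E.
  by apply: integral0_eq => w _; rewrite subrr normr0.
suff ints : bochner_integrable P s.
  by apply: le_trans (bochner_dist ints fs) _; rewrite int0.
split.
  exact: finite_valued_measurable.
pose s' : {mfun T >-> borel B} :=
  HB.pack (s : T -> borel B)
    (isMeasurableFun.Build _ _ _ _ _ (finite_valued_measurable fs)).
exists (fun=> s'); split; first by move=> _; exact: fs.1.
rewrite (_ : (fun _ => _) = (fun=> 0%E)); first exact: cvg_cst.
by apply/funext => _; rewrite int0.
Qed.

End bochner_theory.

(** * Conditional expectation on an atom *)

Section conditional_expectation_on_atoms.
Context {d : measure_display} {T : measurableType d} {R : realType}.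
Context {B : completeNormedModType R}.
Variable P : probability T R.

Lemma finite_valued_indic (A : set T) (u : T -> B) :
  measurable A -> finite_valued u -> finite_valued (fun w => \1_A w *: u w).
Proof.
move=> mA fu.
exact: (finite_valued_map (fun z : bool * B => z.1%:R *: z.2)
  (finite_valued_pair (finite_valued_mem mA) fu)).
Qed.

Lemma measurable_indic (A : set T) (f : T -> B) :
  measurable A -> measurable_fun setT (f : T -> borel B) ->
  measurable_fun setT ((fun w => \1_A w *: f w) : T -> borel B).
Proof.
move=> mA mf.
apply: (@measurable_glue _ _ _ _ (borel B) (fun w => w \in A)
  (fun b w => (b%:R *: (f w : B))%R)); first exact: finite_valued_mem.
move=> b; apply: (@measurableT_comp _ _ _ T (borel B) (borel B)
  (fun x : borel B => (b%:R *: (x : B)))) => //.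
apply: (@continuous_borel_measurable R B B (fun x => b%:R *: x)) => x.
exact: scaler_continuous.
Qed.

Lemma bochner_integrable_indic (A : set T) (f : T -> B) :
  measurable A -> bochner_integrable P f ->
  bochner_integrable P (fun w => \1_A w *: f w).
Proof.
move=> mA [mf [s sf]]; have mAf := measurable_indic mA mf; split=> //.
have fs n : finite_valued (fun w => \1_A w *: (s n w : B)).
  by apply: finite_valued_indic => //; apply: finite_valued_mfun; exact: sf.1.
pose s' n : {mfun T >-> borel B} :=
  HB.pack ((fun w => \1_A w *: (s n w : B)) : T -> borel B)
    (isMeasurableFun.Build _ _ _ _ _ (finite_valued_measurable (fs n))).
exists s'; split; first by move=> n; exact: (fs n).1.
apply: squeeze_cvge (cvg_cst 0%E) sf.2; near=> n; apply/andP; split.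
  by apply: integral_ge0 => w _; rewrite lee_fin.
apply: ge0_le_integral => //.
- by apply/measurable_EFinP; apply: (measurable_norm_sub mAf (fs n)).
- apply/measurable_EFinP; apply: measurable_norm_sub => //.
  by apply: finite_valued_mfun; exact: sf.1.
- move=> w _; rewrite lee_fin /= -scalerBr normrZ indicE.
  by case: (w \in A); rewrite ?normr1 ?mul1r// normr0 mul0r.
Unshelve. all: by end_near.
Qed.

Lemma simple_integral_indic (A : set T) (b : B) : measurable A ->
  simple_integral P (fun w => \1_A w *: b) = fine (P A) *: b.
Proof.
move=> mA; pose u w := w \in A.
have -> : (fun w => \1_A w *: b) = (fun c : bool => c%:R *: b) \o u.
  by apply/funext => w; rewrite /= indicE.
rewrite (simple_integral_comp P _ (finite_valued_mem mA)).
(* If [A] is empty or full, one label is missing from the range of [u]; its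
   fibre is empty and adds nothing to the sum. *)
rewrite (@fsbig_widen _ _ _ _ _ [set` [:: true; false]])/=; last 2 first.
- by move=> [] _ /=.
- move=> c /= [_ nuc]; rewrite (_ : _ @^-1` _ = set0) ?measure0/= ?scale0r//.
  by apply/seteqP; split => // w uw; apply: nuc; exists w.
rewrite -fsbig_seq//= !big_cons big_nil scale0r scaler0 !addr0 scale1r.
congr (fine (P _) *: _).
by apply/seteqP; split => w /=; [move/set_mem|move/mem_set].
Qed.

(** Both [f w0] and [c], multiplied by [P A], are compared with the integral of
    [f] over [A]: the second equals it, and the first differs from it by at most
    the integral of [r] over [A]. *)
Lemma cond_exp_atom_dist (G : set (set T)) (f g : T -> B) (A : set T)
    (w0 : T) (c : B) (r : R) :
  is_cond_exp P G f g -> G A -> measurable A -> (forall w, A w -> g w = c) ->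
  (forall w, A w -> `|f w - f w0| <= r) ->
  `|f w0 - c| * fine (P A) <= r * fine (P A).
Proof.
move=> [fi _ _ fgE] GA mA gc fr.
have fvi (b : B) : finite_valued (fun w => \1_A w *: b).
  apply: finite_valued_indic => //; split.
    by apply: (@sub_finite_set _ _ [set b]) => // _ [w _ <-].
  by move=> b'; rewrite (_ : (fun=> b) = cst b)// preimage_cst; case: ifP.
have intf : bochner P (fun w => \1_A w *: f w) = fine (P A) *: c.
  rewrite fgE// (_ : (fun w => _) = (fun w => \1_A w *: c)).
    by rewrite bochner_simple// simple_integral_indic.
  apply/funext => w; rewrite indicE; case: (boolP (w \in A)) => [/set_mem Aw|].
    by rewrite gc.
  by rewrite !scale0r.
have := bochner_dist (bochner_integrable_indic mA fi) (fvi (f w0)).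
rewrite intf simple_integral_indic// -scalerBr normrZ ger0_norm ?fine_ge0//.
rewrite distrC mulrC => le1.
rewrite -lee_fin (le_trans le1)// EFinM fineK ?fin_num_measure//.
rewrite -integral_cst// integral_mkcond.
apply: ge0_le_integral => //.
- apply/measurable_EFinP; apply: (measurable_norm_sub _ (fvi _)).
  exact: (bochner_integrable_indic mA fi).1.
- apply/(measurable_restrictT _ _).1 => //.
move=> w _; rewrite -scalerBr normrZ patchE indicE.
case: (boolP (w \in A)) => [/set_mem Aw|]; last by rewrite normr0 mul0r.
by rewrite normr1 mul1r lee_fin fr.
Qed.

End conditional_expectation_on_atoms.

(** * Sigma-algebras with finitely many atoms *)

Section saturated.
Context {T I : Type}.
Variable Z : T -> I.

(** The unions of fibres of [Z]. Together with the condition that the fibres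
    belong to [G], the inclusion of [G] in this class says that they are the
    atoms of [G]. *)
Definition saturated (A : set T) := forall w w', Z w = Z w' -> A w -> A w'.

Lemma saturated_sigma_algebra (G : set (set T)) :
  G `<=` saturated -> <<s G >> `<=` saturated.
Proof.
move=> GZ; apply: smallest_sub => //; split=> //.
- move=> A sA w w' zw [_ nAw]; split=> // Aw'; apply: nAw.
  by apply: sA Aw'.
- by move=> F sF w w' zw [n _ Fw]; exists n => //; apply: sF zw Fw.
Qed.

End saturated.

Lemma sigma_join_saturated (T I J : Type) (Z : T -> I) (W : T -> J)
    (G H : set (set T)) : G `<=` saturated Z -> H `<=` saturated W ->
  sigma_join G H `<=` saturated (fun w => (Z w, W w)).
Proof.
move=> GZ HW; apply: saturated_sigma_algebra => A [GA|HA] w w' [zw ww].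
  exact: (GZ _ GA).
exact: (HW _ HA).
Qed.

Lemma sigma_join_label (T : pointedType) (I J : Type) (Z : T -> I) (W : T -> J)
    (G H : set (set T)) :
  (forall i, G (Z @^-1` [set i])) -> (forall j, H (W @^-1` [set j])) ->
  forall i j, sigma_join G H ((fun w => (Z w, W w)) @^-1` [set (i, j)]).
Proof.
move=> GZ HW i j.
rewrite (_ : _ @^-1` _ = Z @^-1` [set i] `&` W @^-1` [set j]); last first.
  by apply/seteqP; split => w /= [-> ->].
apply: (@measurableI _ (g_sigma_algebraType (G `|` H))).
- by apply: sub_sigma_algebra; left; exact: GZ.
- by apply: sub_sigma_algebra; right; exact: HW.
Qed.

(** The exceptional set is the union of the finitely many null fibres. *)
Lemma ae_finite_valued {d} {T : measurableType d} {R : realType}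
    (P : probability T R) (I : choiceType) (Z : T -> I) (Q : T -> Prop) :
  finite_valued Z ->
  (forall w, P (Z @^-1` [set Z w]) != 0%E -> Q w) -> \forall w \ae P, Q w.
Proof.
move=> [fZ mZ] PQ.
exists (\bigcup_(i in range Z `&` [set i | P (Z @^-1` [set i]) = 0%E])
  Z @^-1` [set i]); split.
- by apply: fin_bigcup_measurable => //; exact: finite_setIl.
- rewrite measure_fin_bigcup//; last 2 first.
  + exact: finite_setIl.
  + by move=> i j _ _ [w [/= <- <-]].
  by rewrite fsbig1// => i [_ /= ->].
move=> w /= nQw; exists (Z w) => //; split; first by exists w.
by apply/eqP; apply: contra_notT nQw; exact: PQ.
Qed.

Section finite_conditioning.
Context {d : measure_display} {T : measurableType d} {R : realType}.
Context {B : completeNormedModType R}.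
Variable P : probability T R.

Section atoms.
Context {I : choiceType} (Z : T -> I) (G : set (set T)).
Hypothesis fZ : finite_valued Z.
Hypothesis GZ : forall i, G (Z @^-1` [set i]).
Hypothesis ZG : G `<=` saturated Z.

(** The preimage of the point [g w] belongs to [G], hence is saturated. *)
Lemma cond_exp_constant (f g : T -> B) :
  is_cond_exp P G f g -> forall w w', Z w = Z w' -> g w = g w'.
Proof.
move=> [_ _ gG _] w w' zw.
have : G (g @^-1` [set g w]).
  by apply: gG; exact: borel_measurable_set1.
by move=> /ZG/(_ _ _ zw)/= ->.
Qed.

Lemma cond_exp_finite_valued (f g : T -> B) :
  is_cond_exp P G f g -> finite_valued g.
Proof.
move=> fg; pose c i := g (xget point (Z @^-1` [set i])).
rewrite (_ : g = c \o Z); first exact: finite_valued_map.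
apply/funext => w; apply: (cond_exp_constant fg) => /=.
by apply/esym/(@xgetPex _ point (Z @^-1` [set Z w])); exists w.
Qed.

Lemma cond_exp_diam (f g : T -> B) : is_cond_exp P G f g ->
  \forall w \ae P,
    (`|f w - g w|%:E <= diam (f @` (Z @^-1` [set Z w])))%E.
Proof.
move=> fg; apply: (ae_finite_valued fZ) => w PZw.
set A := Z @^-1` _ in PZw *.
have diam_ge w' : A w' -> (`|f w' - f w|%:E <= diam (f @` A))%E.
  move=> Aw'.
  apply: ereal_sup_ubound; exists (f w', f w) => //.
  by split; [exists w'|exists w].
(* An infinite diameter bounds everything; [-oo] is excluded by [w] itself. *)
case Ed : (diam (f @` A)) diam_ge => [r| |] diam_ge; last 2 first.
- by rewrite leey.
- by have := diam_ge w erefl; rewrite leeNy_eq.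
have PA0 : 0 < fine (P A).
  by rewrite fine_gt0// lt0e PZw measure_ge0 ltey_eq fin_num_measure//; exact: fZ.2.
rewrite lee_fin -(ler_pM2r PA0).
apply: (cond_exp_atom_dist fg) => //.
- exact: GZ.
- exact: fZ.2.
- by move=> w' ?; apply: (cond_exp_constant fg).
Qed.

End atoms.

(** * Conditioning on the cells of a partition *)

Section partitions.
Context {m : nat} (X : {mfun T >-> borel B}) (Pi : 'I_m -> set B).
Context (lab : B -> 'I_m).
Hypothesis bPi : borel_partition Pi.
Hypothesis labE : forall i, lab @^-1` [set i] = Pi i.

Lemma label_finite_valued : finite_valued (lab \o X).
Proof.
split; first exact: finite_finset.
move=> i; rewrite comp_preimage labE -[X in measurable X]setTI.
by apply: (@measurable_funPT _ _ _ _ X) => //; exact: bPi.2.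
Qed.

Lemma sigma_preim_label i : sigma_preim X Pi ((lab \o X) @^-1` [set i]).
Proof.
apply: sub_sigma_algebra; exists (Pi i); first by exists i.
by rewrite setTI comp_preimage labE.
Qed.

Lemma sigma_preim_saturated : sigma_preim X Pi `<=` saturated (lab \o X).
Proof.
apply: saturated_sigma_algebra => _ [_ [i _ <-] <-] w w' /= zw.
by rewrite -labE /= zw.
Qed.

Lemma label_cell i w w' :
  (lab \o X) w = (lab \o X) w' -> Pi i (X w) -> Pi i (X w').
Proof. by rewrite -labE /= => ->. Qed.

End partitions.

Lemma partition_label m (Pi : 'I_m -> set B) : borel_partition Pi ->
  exists lab : B -> 'I_m, forall i, lab @^-1` [set i] = Pi i.
Proof.
move=> [[cPi tPi _] _].
have /choice[lab labP] : forall b, exists i, Pi i b.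
  by move=> b; have : [set: B] b by []; rewrite -cPi => -[i _ ?]; exists i.
exists lab => i; apply/seteqP; split => b /=; first by move=> <-.
by move=> Pib; apply: tPi => //; exists b.
Qed.

(** * Bounds in L^p and Wasserstein distance *)

Lemma diam_le (E F : set B) : E `<=` F -> (diam E <= diam F)%E.
Proof.
move=> EF; apply: le_ereal_sup => _ [z [Ez1 Ez2] <-]; exists z => //.
by split; exact: EF.
Qed.

(** The integral splits over the cells of the partition, and the null cells,
    left out of the sum, contribute nothing even if their diameter is
    infinite. *)
Lemma Lp_dist_le_diam_sum (p : R) m (Pi : 'I_m -> set B)
    (X : {mfun T >-> borel B}) (g : T -> B) :
  1 <= p -> borel_partition Pi -> finite_valued g ->
  (\forall w \ae P, forall i, Pi i (X w) ->
     (`|(X w : B) - g w|%:E <= diam (Pi i))%E) ->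
  (normLp P p (fun w => (X w : B) - g w)%R `^ p <=
   diam_sum p (distribution P X) Pi)%E.
Proof.
move=> p1 bPi fg Xg; have p0 : p != 0 by rewrite gt_eqF// (lt_le_trans _ p1).
rewrite /normLp poweR_Lnorm//.
have mh : measurable_fun [set: T]
    (fun w => `| `|(X w : B) - g w|%R%:E| `^ p)%E.
  apply: (@measurableT_comp _ _ _ _ _ _ (fun x : \bar R => x `^ p)%E).
    exact: measurable_poweR.
  apply: measurableT_comp => //; apply/measurable_EFinP.
  by apply: measurable_norm_sub.
have mPi i : measurable (X @^-1` Pi i).
  rewrite -[X in measurable X]setTI.
  by apply: (@measurable_funPT _ _ _ _ X) => //; exact: bPi.2.
have TE : setT = \big[setU/set0]_(i < m) X @^-1` Pi i.
  rewrite -(bigcup_seq (index_enum 'I_m)); apply/seteqP; split => // w _.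
  have : [set: B] (X w) by [].
  have [cPi _ _] := bPi.1; rewrite -cPi => -[i _ PiXw].
  by exists i => //=; exact: mem_index_enum.
rewrite {1}TE ge0_integral_bigsetU ?index_enum_uniq//; last 3 first.
- have [_ tPi _] := bPi.1.
  by move=> i j _ _ [w [Pi_i Pi_j]]; apply: tPi => //; exists (X w).
- by rewrite -TE.
- by move=> w _; exact: poweR_ge0.
rewrite /diam_sum big_mkcond/= [leRHS]big_mkcond/=; apply: lee_sum => i _.
case: ifPn => [Pi0|]; last first.
  rewrite -leNgt measure_le0 => /eqP Pi0.
  by rewrite null_set_integral//; exact: measurable_funTS.
rewrite -[distribution P X (Pi i)]/(P (X @^-1` Pi i)) -integral_cst//.
apply: ae_ge0_le_integral => //; first exact: measurable_funTS.
  by move=> w _; exact: poweR_ge0.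
apply: filterS Xg => w Xg /Xg le1.
have p_ge0 : 0 <= p by exact: le_trans p1.
apply: (gt0_ler_poweR p_ge0 _ _ (_ : (`| `|(X w : B) - g w|%R%:E | <= _)%E)).
- by rewrite in_itv/= leey andbT lee_fin.
- by rewrite in_itv/= leey andbT (le_trans _ le1)// lee_fin.
- by rewrite gee0_abs// lee_fin.
Qed.

Lemma wasserstein_le_Lp_dist (p : R) (X Xhat : {mfun T >-> borel B}) :
  1 <= p -> finite_valued (Xhat : T -> B) ->
  (wasserstein p (distribution P X) (distribution P Xhat) `^ p <=
   normLp P p (fun w => (X w : B) - (Xhat w : B))%R `^ p)%E.
Proof.
move=> p1 fX; have p0 : p != 0 by rewrite gt_eqF// (lt_le_trans _ p1).
rewrite /normLp poweR_Lnorm// /wasserstein -poweRrM mulVf// poweRe1; last first.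
  apply: le_ereal_inf_tmp => _ [pi _ <-]; apply: integral_ge0 => z _.
  by rewrite lee_fin powR_ge0.
have mXX : measurable_fun setT
    ((fun w => (X w : B, Xhat w : B)) : T -> borel (B * B)%type).
  apply: (@measurable_glue _ _ B _ (borel (B * B)%type) (Xhat : T -> B)
    (fun b w => (X w : B, b))) => // b.
  apply: (@measurableT_comp _ _ _ T (borel B) (borel (B * B)%type)
    (fun x : borel B => (x : B, b))) => //.
  apply: (@continuous_borel_measurable R B (B * B)%type
    (fun x : B => (x, b) : B * B)) => x.
  by apply: cvg_pair => //; exact: cvg_cst.
pose XX : {mfun T >-> borel (B * B)%type} := HB.pack
  ((fun w => (X w : B, Xhat w : B)) : T -> borel (B * B)%type)
  (isMeasurableFun.Build _ _ _ _ _ mXX).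
apply: ereal_inf_lbound; exists (distribution P XX).
  by move=> A mA; split.
rewrite ge0_integral_distribution//; last first.
  apply/measurable_EFinP.
  apply: (@measurableT_comp _ _ _ _ _ _ (fun x : R => x `^ p)) => //.
  apply: (@continuous_real_measurable R (B * B)%type
    (fun z : B * B => `|z.1 - z.2|)) => z.
  by apply: cvg_norm; apply: cvgB; [exact: cvg_fst|exact: cvg_snd].
by apply: eq_integral => w _; rewrite /= normr_id.
Qed.

(** The atoms may be finer than the cells [X @^-1` Pi i]: what matters is that
    [X] maps each atom into a single cell of [Pi]. This is what lets the
    conditional expectation of [Y] depend on the cell of [X] as well. *)
Lemma cond_exp_partition_bounds (p : R) m (Pi : 'I_m -> set B)
    (X Xhat : {mfun T >-> borel B}) (I : choiceType) (Z : T -> I)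
    (G : set (set T)) :
  1 <= p -> borel_partition Pi ->
  finite_valued Z -> (forall i, G (Z @^-1` [set i])) -> G `<=` saturated Z ->
  (forall i w w', Z w = Z w' -> Pi i (X w) -> Pi i (X w')) ->
  is_cond_exp P G X Xhat ->
  (wasserstein p (distribution P X) (distribution P Xhat) `^ p
     <= normLp P p (fun w => (X w : B) - (Xhat w : B))%R `^ p)%E /\
  (normLp P p (fun w => (X w : B) - (Xhat w : B))%R `^ p
     <= diam_sum p (distribution P X) Pi)%E.
Proof.
move=> p1 bPi fZ GZ ZG ZPi ce; have fX := cond_exp_finite_valued fZ ZG ce.
split; first exact: wasserstein_le_Lp_dist.
apply: Lp_dist_le_diam_sum => //.
apply: filterS (cond_exp_diam fZ GZ ZG ce) => w le1 i Piw.
apply: le_trans le1 _; apply: diam_le => _ [w' /= zw <-].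
exact: ZPi Piw.
Qed.

End finite_conditioning.

Theorem theorem16 (R : realType) (B : completeNormedModType R)
  (sepB : separable B)
  (d : measure_display) (T : measurableType d) (P : probability T R)
  (p : R) (p1 : 1 <= p)
  (X Y : {mfun T >-> borel B})
  (Xp : (normLp P p X < +oo)%E) (Yp : (normLp P p Y < +oo)%E)
  (YX : is_cond_exp P (preimage_set_system setT X measurable) Y X) :
  (forall (m1 m2 : nat) (Pi1 : 'I_m1 -> set B) (Pi2 : 'I_m2 -> set B)
      (Xhat Yhat : {mfun T >-> borel B}),
    borel_partition Pi1 -> borel_partition Pi2 ->
    is_cond_exp P (sigma_preim X Pi1) X Xhat ->
    is_cond_exp P (sigma_join (sigma_preim X Pi1) (sigma_preim Y Pi2)) Y Yhat ->
    [/\ (wasserstein p (distribution P X) (distribution P Xhat) `^ p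
          <= normLp P p (fun w => (X w : B) - (Xhat w : B))%R `^ p)%E,
        (normLp P p (fun w => (X w : B) - (Xhat w : B))%R `^ p
          <= diam_sum p (distribution P X) Pi1)%E,
        (wasserstein p (distribution P Y) (distribution P Yhat) `^ p
          <= normLp P p (fun w => (Y w : B) - (Yhat w : B))%R `^ p)%E &
        (normLp P p (fun w => (Y w : B) - (Yhat w : B))%R `^ p
          <= diam_sum p (distribution P Y) Pi2)%E])
  /\
  (forall (m1 m2 : nat -> nat)
      (Pi1 : forall n, 'I_(m1 n) -> set B) (Pi2 : forall n, 'I_(m2 n) -> set B)
      (Xn Yn : nat -> {mfun T >-> borel B}),
    (forall n, borel_partition (Pi1 n)) ->
    (forall n, borel_partition (Pi2 n)) ->
    (forall n, sigma_of (Pi1 n) `<=` sigma_of (Pi1 n.+1)) ->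
    (forall n, sigma_of (Pi2 n) `<=` sigma_of (Pi2 n.+1)) ->
    <<s \bigcup_n range (Pi1 n) >> = (measurable : set (set (borel B))) ->
    <<s \bigcup_n range (Pi2 n) >> = (measurable : set (set (borel B))) ->
    (forall n, is_cond_exp P (sigma_preim X (Pi1 n)) X (Xn n)) ->
    (forall n, is_cond_exp P
      (sigma_join (sigma_preim X (Pi1 n)) (sigma_preim Y (Pi2 n))) Y (Yn n)) ->
    forall n,
      (wasserstein p (distribution P X) (distribution P (Xn n)) `^ p
        <= diam_sum p (distribution P X) (Pi1 n))%E /\
      (wasserstein p (distribution P Y) (distribution P (Yn n)) `^ p
        <= diam_sum p (distribution P Y) (Pi2 n))%E).
Proof.
have main : forall (m1 m2 : nat) (Pi1 : 'I_m1 -> set B) (Pi2 : 'I_m2 -> set B)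
      (Xhat Yhat : {mfun T >-> borel B}),
    borel_partition Pi1 -> borel_partition Pi2 ->
    is_cond_exp P (sigma_preim X Pi1) X Xhat ->
    is_cond_exp P (sigma_join (sigma_preim X Pi1) (sigma_preim Y Pi2)) Y Yhat ->
    [/\ (wasserstein p (distribution P X) (distribution P Xhat) `^ p
          <= normLp P p (fun w => (X w : B) - (Xhat w : B))%R `^ p)%E,
        (normLp P p (fun w => (X w : B) - (Xhat w : B))%R `^ p
          <= diam_sum p (distribution P X) Pi1)%E,
        (wasserstein p (distribution P Y) (distribution P Yhat) `^ p
          <= normLp P p (fun w => (Y w : B) - (Yhat w : B))%R `^ p)%E &
        (normLp P p (fun w => (Y w : B) - (Yhat w : B))%R `^ p
          <= diam_sum p (distribution P Y) Pi2)%E].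
  move=> m1 m2 Pi1 Pi2 Xhat Yhat bPi1 bPi2 ceX ceY.
  have [lab1 lab1E] := partition_label bPi1.
  have [lab2 lab2E] := partition_label bPi2.
  have fX := label_finite_valued X bPi1 lab1E.
  have fY := label_finite_valued Y bPi2 lab2E.
  have [WX NX] := cond_exp_partition_bounds p1 bPi1 fX
    (sigma_preim_label (X := X) lab1E) (sigma_preim_saturated (X := X) lab1E)
    (label_cell (X := X) lab1E) ceX.
  pose Z w := (lab1 (X w), lab2 (Y w)).
  have GZ : forall ij, sigma_join (sigma_preim X Pi1) (sigma_preim Y Pi2)
      (Z @^-1` [set ij]).
    move=> [i j].
    exact: (sigma_join_label (sigma_preim_label (X := X) lab1E)
      (sigma_preim_label (X := Y) lab2E)).
  have ZG := sigma_join_saturated (sigma_preim_saturated (X := X) lab1E)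
    (sigma_preim_saturated (X := Y) lab2E).
  have ZPi : forall i w w', Z w = Z w' -> Pi2 i (Y w) -> Pi2 i (Y w').
    by move=> i w w' [_]; exact: (label_cell (X := Y) lab2E).
  have [WY NY] := cond_exp_partition_bounds p1 bPi2 (finite_valued_pair fX fY)
    GZ ZG ZPi ceY.
  by split.
split; first exact: main.
move=> m1 m2 Pi1 Pi2 Xn Yn bPi1 bPi2 _ _ _ _ ceX ceY n.
have [WX NX WY NY] := main _ _ _ _ _ _ (bPi1 n) (bPi2 n) (ceX n) (ceY n).
by split; [exact: le_trans NX | exact: le_trans NY].
Qed.
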